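(* For every $n$ and every $1\le j\le n$, $\widetilde{H}_{j-1}(D_n)\cong\mathbb{Z}^{D(n,j,j)}$, where $D(n,j,j)$ is the number of partitions of $[n]$ into exactly $j$ blocks, none of which is a singleton.
   Context: $[n]=\{1,\dots,n\}$. A partial partition of $[n]$ is a set of pairwise disjoint nonempty subsets (blocks) of $[n]$. $D_n$ is the abstract simplicial complex whose vertices are the nonempty subsets of $[n]$ and whose faces are the partial partitions of $[n]$ (ordered by inclusion). $\widetilde{H}_\ast$ denotes reduced simplicial homology with integer coefficients. *)

(* Defs.v *)
From HB Require Import structures.
From mathcomp Require Import all_boot all_order all_algebra.
From mathcomp Require Import boolp.
From mathcomp Require Import zify.

Set Implicit Arguments.
Unset Strict Implicit.
Unset Printing Implicit Defensive.

Import Order.TTheory GRing.Theory Num.Theory.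
Local Open Scope ring_scope.

(* Every element of V is a vertex, and the empty face (of dimension -1) always
   belongs to the complex, as needed for the augmented chain complex. *)
Record simplicial_complex (V : finType) := SimplicialComplex {
  faces :> {set {set V}};
  face0 : set0 \in faces;
  face1 : forall v : V, [set v] \in faces;
  face_sub : forall F G : {set V}, F \in faces -> G \subset F -> G \in faces
}.

Section Homology.
Variables (V : finType) (K : simplicial_complex V).

(* The faces with m vertices, i.e. of dimension m - 1. *)
Definition simplex (m : nat) := {F : {set V} | (F \in faces K) && (#|F| == m)}.

(* Faces are oriented by the enumeration order of V: enum F lists the vertices
   v_0, ..., v_k of F in increasing order. *)
Definition chain (m : nat) := {ffun simplex m -> int}.

(* The coefficient of G in
   boundary [v_0, ..., v_k] = \sum_i (-1)^i [v_0, ..., v_i omitted, ..., v_k]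
   where F = {v_0, ..., v_k}. *)
Definition incidence (F G : {set V}) : int :=
  \sum_(v in F | F :\ v == G) (-1) ^+ index v (enum F).

(* The boundary on faces with one vertex (m = 0) is the augmentation. *)
Definition boundary (m : nat) (c : chain m.+1) : chain m :=
  [ffun G : simplex m =>
     \sum_(F : simplex m.+1) c F * incidence (val F) (val G)].

Fact boundary_is_zmod_morphism (m : nat) : zmod_morphism (@boundary m).
Proof.
move=> c d; apply/ffunP => G; rewrite !ffunE -sumrB; apply: eq_bigr => F _.
by rewrite !ffunE mulrBl.
Qed.

HB.instance Definition _ (m : nat) :=
  GRing.isZmodMorphism.Build (chain m.+1) (chain m) (@boundary m)
    (@boundary_is_zmod_morphism m).

Definition cycle_pred (m : nat) : {pred chain m.+1} :=
  [pred c | boundary c == 0].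

Fact cycle_zmod_closed (m : nat) : zmod_closed (@cycle_pred m).
Proof.
split=> [|c d]; rewrite !inE ?raddf0 // => /eqP c0 /eqP d0.
by rewrite raddfB /= c0 d0 subr0.
Qed.

HB.instance Definition _ (m : nat) :=
  GRing.isZmodClosed.Build (chain m.+1) (@cycle_pred m) (@cycle_zmod_closed m).

Record cycle_group (m : nat) := Cycle {
  cycle_val :> chain m.+1;
  _ : cycle_val \in @cycle_pred m
}.

HB.instance Definition _ (m : nat) := [isSub for @cycle_val m].
HB.instance Definition _ (m : nat) := [Choice of cycle_group m by <:].
HB.instance Definition _ (m : nat) :=
  [SubChoice_isSubZmodule of cycle_group m by <:].

Definition boundary_pred (m : nat) : {pred cycle_group m} :=
  [pred z : cycle_group m | `[< exists c : chain m.+2, boundary c = val z >]].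

Fact boundary_zmod_closed (m : nat) : zmod_closed (@boundary_pred m).
Proof.
split=> [|y z]; rewrite !inE.
  by apply/asboolP; exists 0; rewrite !raddf0.
move=> /asboolP[c cy] /asboolP[d dz]; apply/asboolP; exists (c - d).
by rewrite !raddfB /= cy dz.
Qed.

HB.instance Definition _ (m : nat) :=
  GRing.isZmodClosed.Build (cycle_group m) (@boundary_pred m)
    (@boundary_zmod_closed m).

(* cycle_group m consists of combinations of faces with m + 1 vertices, so this
   is the reduced homology group in dimension m. *)
Definition reduced_homology (m : nat) : zmodType :=
  Quotient.quot (@boundary_pred m).

Lemma index_enum_card (F : {set V}) (v : V) : v \in F ->
  index v (enum F) = #|[set w in F | (enum_rank w < enum_rank v)%N]|.
Proof.
move=> vF.
have sE : sorted (fun x y : V => (enum_rank x < enum_rank y)%N) (enum F).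
  rewrite {1}/enum_mem; apply: sorted_filter.
    by move=> x y z; apply: ltn_trans.
  rewrite -enumT.
  suff : sorted ltn [seq (enum_rank x : nat) | x <- enum V].
    by rewrite sorted_map.
  suff -> : [seq (enum_rank x : nat) | x <- enum V] = iota 0 #|V|.
    by apply: iota_ltn_sorted.
  apply: (@eq_from_nth _ 0%N); first by rewrite size_map size_iota cardE.
  move=> i; rewrite size_map -cardE => ltiV.
  rewrite (nth_map v) -?cardE // nth_iota // add0n.
  have -> : nth v (enum V) i = enum_val (Ordinal ltiV : 'I_#|V|).
    by rewrite (enum_val_nth v).
  by rewrite enum_valK.
move: (enum_uniq F) (mem_enum F) sE; move: (enum F) => s Us sF sE.
have vs : v \in s by rewrite sF.
have -> : #|[set w in F | (enum_rank w < enum_rank v)%N]|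
         = count (fun w => enum_rank w < enum_rank v)%N s.
  rewrite -size_filter -(card_uniqP (filter_uniq _ Us)).
  by apply: eq_card => w; rewrite !inE mem_filter sF andbC.
case/splitPr: vs Us sE {sF} => s1 s2 Us.
rewrite sorted_pairwise; last by move=> x y z; apply: ltn_trans.
rewrite pairwise_cat /= => /and3P[/allrelP r1 _ /andP[/allP r2 _]].
move: Us; rewrite cat_uniq /= => /and3P[_ /norP[vs1 _] _].
rewrite index_cat (negPf vs1) /= eqxx addn0 count_cat /= ltnn add0n.
rewrite (eq_in_count (a2 := predT)) ?count_predT; last first.
  by move=> w ws1; rewrite /= r1 // inE eqxx.
rewrite (eq_in_count (a2 := pred0)) ?count_pred0 ?addn0 // => w /r2 /ltnW.
by rewrite leqNgt => /negPf.
Qed.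

Lemma incidence_swap (F : {set V}) (v w : V) : v \in F -> w \in F -> v != w ->
  (-1) ^+ index v (enum F) * (-1) ^+ index w (enum (F :\ v)) =
  - ((-1) ^+ index w (enum F) * (-1) ^+ index v (enum (F :\ w))) :> int.
Proof.
wlog ltvw : v w / (enum_rank v < enum_rank w)%N.
  move=> IH vF wF nvw.
  case: (ltngtP (enum_rank v) (enum_rank w)) => [lt|gt|/val_inj/enum_rank_inj e].
  - exact: IH.
  - by rewrite (IH w v) // 1?eq_sym // opprK.
  - by rewrite e eqxx in nvw.
move=> vF wF nvw.
rewrite (index_enum_card vF) (index_enum_card wF).
rewrite [index w _]index_enum_card; last by rewrite !inE eq_sym nvw.
rewrite [index v _]index_enum_card; last by rewrite !inE nvw.
have -> : [set x in F :\ w | (enum_rank x < enum_rank v)%N]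
        = [set x in F | (enum_rank x < enum_rank v)%N].
  apply/setP => x; rewrite !inE; case: eqVneq => [->|] //=.
  by rewrite [RHS]andbC ltnNge (ltnW ltvw).
rewrite [in RHS](cardsD1 v) inE vF ltvw /= add1n exprS mulN1r mulNr opprK mulrC.
congr (_ ^+ _ * _); apply: eq_card => x; rewrite !inE.
by rewrite andbA.
Qed.

Lemma boundary_boundary (m : nat) (c : chain m.+2) : boundary (boundary c) = 0.
Proof.
apply/ffunP => H; rewrite !ffunE.
under eq_bigr => G _ do rewrite ffunE mulr_suml.
rewrite exchange_big big1 //= => F _.
under eq_bigr => G _ do rewrite -mulrA.
rewrite -mulr_sumr [X in _ * X](_ : _ = 0) ?mulr0 //.
have /andP[FK /eqP cF] := valP F.
pose T v w : int :=
  (-1) ^+ index v (enum (val F)) * (-1) ^+ index w (enum (val F :\ v)).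
pose P v w := [&& v \in val F, w \in val F, v != w & val F :\ v :\ w == val H].
transitivity (\sum_v \sum_(w | P v w) T v w).
  rewrite /incidence.
  under eq_bigr => G _ do rewrite mulr_suml big_mkcondr /=.
  rewrite exchange_big [RHS]big_mkcond [LHS]big_mkcond /=.
  apply: eq_bigr => v _; case: ifP => vF; last first.
    by rewrite big_pred0 // => w; rewrite /P vF.
  have vK : (val F :\ v \in faces K) && (#|val F :\ v| == m.+1).
    rewrite (face_sub FK (subsetDl _ _)) /=.
    by apply/eqP; move: cF; rewrite (cardsD1 v) vF add1n => -[].
  rewrite (bigD1 (Sub (val F :\ v) vK : simplex m.+1)) //= eqxx.
  rewrite [X in _ + X]big1 ?addr0; last first.
    move=> G nG; case: ifP => // /eqP e; case/negP: nG; apply/eqP/val_inj.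
    by rewrite /= e.
  rewrite mulr_sumr; apply: eq_bigl => w; rewrite /P vF !inE /=.
  by rewrite eq_sym andbA [_ && (v != w)]andbC.
set S := (X in X = 0).
suff : S = - S by lia.
rewrite {1}/S (exchange_big_dep xpredT) //= /S -sumrN; apply: eq_bigr => v _.
rewrite -sumrN; apply: eq_big => [w|w /and4P[wF vF nwv _]].
  rewrite /P eq_sym andbCA; congr [&& _, _, _ & _ == _].
  by rewrite !setDDl setUC.
exact: incidence_swap.
Qed.

End Homology.

Definition isomorphic_zmod (A B : zmodType) : Prop :=
  exists f : {additive A -> B}, bijective f.

Section PartialPartitions.
Variable n : nat.

Definition partial_partition (P : {set {set 'I_n}}) : bool :=
  trivIset P && (set0 \notin P).

Definition nonempty_subset := {B : {set 'I_n} | B != set0}.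

Definition Dn_faces : {set {set nonempty_subset}} :=
  [set P : {set nonempty_subset} | partial_partition [set val B | B in P]].

Fact Dn_face0 : set0 \in Dn_faces.
Proof.
rewrite inE /partial_partition imset0 inE andbT.
by apply/trivIsetP => A B; rewrite inE.
Qed.

Fact Dn_face1 (B : nonempty_subset) : [set B] \in Dn_faces.
Proof.
rewrite inE /partial_partition imset_set1 inE eq_sym (valP B) andbT.
by apply/trivIsetP => A C /set1P-> /set1P->; rewrite eqxx.
Qed.

Fact Dn_face_sub (P Q : {set nonempty_subset}) :
  P \in Dn_faces -> Q \subset P -> Q \in Dn_faces.
Proof.
rewrite !inE => /andP[tP P0] QP; have sQP := imsetS val QP.
by rewrite /partial_partition (trivIsetS sQP tP) (contra (subsetP sQP _) P0).
Qed.

Definition Dn : simplicial_complex nonempty_subset :=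
  SimplicialComplex Dn_face0 Dn_face1 Dn_face_sub.

Definition num_nosingleton_partitions (j : nat) : nat :=
  #|[set P : {set {set 'I_n}} |
     [&& partition P [set: 'I_n], #|P| == j & [forall B in P, #|B| != 1%N]]]|.

End PartialPartitions.

(* Main.v *)
Require Import Defs.
From mathcomp Require Import all_boot all_algebra.
From HB Require Import structures.
From mathcomp Require Import boolp ring.

(** Write [v_i] for the vertex [{i}], and call a face critical if it is a
    partition of [[n]] without singletons.  The critical faces are maximal, and
    a face [P] is non-critical exactly when [v_i |: P] is a face for some [i].
    So the non-critical faces form the union [L] of the stars of the [v_i].
    Adding the stars one at a time, each meets the union of the previous ones in
    a cone with apex [v_i], because [v_i |: P] and [v_k |: P] being faces makes
    [v_i |: (v_k |: P)] one; hence [L] is acyclic by Mayer-Vietoris.  The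
    homology of the complex is therefore the relative homology of the pair,
    which is free on the critical faces. *)

Set Implicit Arguments.
Unset Strict Implicit.
Unset Printing Implicit Defensive.

Import GRing.Theory.

Lemma setU1D1 (T : finType) (A : {set T}) (x y : T) :
  x != y -> (x |: A) :\ y = x |: A :\ y.
Proof.
move=> nxy; rewrite setDUl; congr (_ :|: _); apply/setDidPl.
by rewrite disjoints1 inE.
Qed.

Section FirstIsomorphism.
Local Open Scope ring_scope.
Local Open Scope quotient_scope.

Lemma quot_isomorphic (M N : zmodType) (S : zmodClosed M)
    (f : {additive M -> N}) :
  (forall y, exists x, f x = y) -> (forall x, (f x == 0) = (x \in S)) ->
  isomorphic_zmod (Quotient.quot S) N.
Proof.
move=> f_surj ker_f.
pose g (x : Quotient.quot S) : N := f (repr x).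
have g_pi x : g (\pi x) = f x.
  by apply/eqP; rewrite -subr_eq0 -raddfB ker_f Quotient.idealrBE reprK.
have g_additive : zmod_morphism g.
  by move=> x y; rewrite -[x]reprK -[y]reprK -raddfB !g_pi raddfB.
have g_inj : injective g.
  move=> x y /eqP; rewrite -subr_eq0 -raddfB ker_f Quotient.idealrBE !reprK.
  by move/eqP.
have /choice[h fhK] := f_surj.
have hK : cancel (\pi \o h) g by move=> y; rewrite /= g_pi.
pose g_add : {additive _ -> _} :=
  HB.pack g (GRing.isZmodMorphism.Build _ _ g g_additive).
by exists g_add, (\pi \o h); first exact: inj_can_sym hK g_inj.
Qed.

End FirstIsomorphism.

(* Ungraded chains of the full simplex on V, including the empty face. *)
Local Notation total_chain V := {ffun {set V} -> int}.

Section TotalChains.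
Local Open Scope ring_scope.
Variable V : finType.
Implicit Types (F G : {set V}) (v w : V) (A B : {set {set V}}).
Implicit Types c z : total_chain V.

Definition face_sign F v : int := (-1) ^+ index v (enum F).

Definition total_boundary c : total_chain V :=
  [ffun G : {set V} => \sum_(v | v \notin G) face_sign (v |: G) v * c (v |: G)].

Definition cone v c : total_chain V :=
  [ffun F : {set V} => if v \in F then face_sign F v * c (F :\ v) else 0].

Lemma face_sign_sqr F v : face_sign F v * face_sign F v = 1.
Proof. by rewrite -expr2 sqrr_sign. Qed.

Lemma face_sign_exchange G v w : v \in G -> w \notin G ->
  face_sign (w |: G) w * face_sign (w |: G) v =
  - (face_sign G v * face_sign (w |: G :\ v) w).
Proof.
move=> vG wG; have nwv : w != v by apply: contraNneq wG => ->.
have := @incidence_swap _ (w |: G) w v; rewrite !inE eqxx vG orbT nwv.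
move=> /(_ isT isT isT); rewrite setU1K // setU1D1 // -!/(face_sign _ _).
have := face_sign_sqr G v; have := face_sign_sqr (w |: G) v.
set s := face_sign (w |: G) v; set t := face_sign G v => ss tt swap.
rewrite -[LHS]mulr1 -tt mulrACA swap mulNr; congr (- _).
rewrite -[RHS]mulr1 -ss; ring.
Qed.

Lemma total_boundary_is_zmod_morphism : zmod_morphism total_boundary.
Proof.
move=> c d; apply/ffunP => G; rewrite !ffunE -sumrB.
by apply: eq_bigr => v _; rewrite !ffunE mulrBr.
Qed.

HB.instance Definition _ :=
  GRing.isZmodMorphism.Build (total_chain V) (total_chain V) total_boundary
    total_boundary_is_zmod_morphism.

Lemma total_boundary_cone v c :
  total_boundary (cone v c) + cone v (total_boundary c) = c.
Proof.
apply/ffunP => G; rewrite !ffunE; case: ifP => vG; last first.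
  rewrite addr0 (bigD1 v) ?vG //= ffunE setU11 setU1K ?vG // mulrA.
  rewrite face_sign_sqr mul1r big1 ?addr0 // => w /andP[_ nwv].
  by rewrite ffunE !inE vG orbF eq_sym (negPf nwv) mulr0.
rewrite (bigD1 (P := fun w => w \notin G :\ v) v) ?inE ?eqxx //=.
rewrite setD1K // mulrDr mulrA face_sign_sqr mul1r addrCA mulr_sumr.
rewrite [X in _ + (_ + X)](eq_bigl (fun w => w \notin G)); last first.
  by move=> w; rewrite !inE; case: eqVneq => [->|]; rewrite ?vG ?andbT.
rewrite -big_split big1 ?addr0 //= => w wG.
have nwv : w != v by apply: contraNneq wG => ->.
rewrite ffunE inE vG orbT setU1D1 // !mulrA face_sign_exchange //.
by rewrite mulNr addNr.
Qed.

Definition down_closed A : Prop :=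
  forall F G, F \in A -> G \subset F -> G \in A.

Definition cone_closed v A : Prop := forall F, F \in A -> v |: F \in A.

Definition supported A : {pred total_chain V} := 
  [pred c : total_chain V | support c \subset A].

Lemma supportedP A c :
  reflect (forall F, F \notin A -> c F = 0) (c \in supported A).
Proof.
apply: (iffP subsetP) => cA F; last first.
  by rewrite inE; apply: contra_neqT; apply: cA.
by apply: contraNeq => cF; apply: cA.
Qed.

Lemma supported_zmod_closed A : zmod_closed (supported A).
Proof.
split=> [|c d /supportedP cA /supportedP dA]; apply/supportedP => F FA.
  by rewrite ffunE.
by rewrite !ffunE cA // dA // subrr.
Qed.

HB.instance Definition _ A :=
  GRing.isZmodClosed.Build (total_chain V) (supported A)
    (supported_zmod_closed A).

Lemma supportedS A B c : A \subset B -> c \in supported A -> c \in supported B.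
Proof. by move=> AB /subset_trans; apply. Qed.

Lemma supportedI A B c :
  (c \in supported (A :&: B)) = (c \in supported A) && (c \in supported B).
Proof.
apply/idP/andP => [cAB|[/supportedP cA /supportedP cB]].
  by split; apply: supportedS cAB; rewrite ?subsetIl ?subsetIr.
by apply/supportedP => F; rewrite inE negb_and => /orP[/cA|/cB].
Qed.

Lemma supportedU A B c : c \in supported (A :|: B) ->
  exists2 a, a \in supported A & c - a \in supported B.
Proof.
move=> /supportedP cAB; exists [ffun F => if F \in A then c F else 0].
  by apply/supportedP => F FA; rewrite ffunE (negPf FA).
apply/supportedP => F FB; rewrite !ffunE.
by case: ifPn => FA; rewrite ?subrr // subr0 cAB // inE negb_or FA.
Qed.

Lemma supported_row A (a : 'rV[int]_#|A|) :
  exists2 c, c \in supported A & forall i, c (enum_val i) = a 0 i.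
Proof.
exists [ffun F => \sum_(i | enum_val i == F) a 0 i] => [|i].
  apply/supportedP => F FA; rewrite ffunE big_pred0 // => i.
  by apply: contraNF FA => /eqP<-; apply: enum_valP.
by rewrite ffunE (big_pred1 i) // => k; rewrite (inj_eq enum_val_inj).
Qed.

Lemma total_boundary_supported A c :
  down_closed A -> c \in supported A -> total_boundary c \in supported A.
Proof.
move=> downA /supportedP cA; apply/supportedP => F FA.
rewrite ffunE big1 // => v _; rewrite cA ?mulr0 //.
by apply: contra FA => /downA; apply; apply: subsetUr.
Qed.

Lemma cone_supported A v c :
  cone_closed v A -> c \in supported A -> cone v c \in supported A.
Proof.
move=> coneA /supportedP cA; apply/supportedP => F FA; rewrite ffunE.
case: ifP => // vF; rewrite cA ?mulr0 //.
by apply: contra FA => /coneA; rewrite setD1K.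
Qed.

End TotalChains.

Section GradedComponents.
Local Open Scope ring_scope.
Variables (V : finType) (K : simplicial_complex V).
Implicit Types (F G : {set V}) (c : total_chain V).

Definition component m c : chain K m := [ffun F : simplex K m => c (val F)].

Definition extend m (c : chain K m) : total_chain V :=
  [ffun F : {set V} => oapp c 0 (insub F : option (simplex K m))].

Lemma extendK m : cancel (@extend m) (component m).
Proof. by move=> c; apply/ffunP => F; rewrite !ffunE valK. Qed.

Lemma extend_notin m (c : chain K m) F :
  ~~ ((F \in faces K) && (#|F| == m)) -> extend c F = 0.
Proof. by move=> /negPf notF; rewrite ffunE insubF. Qed.

Lemma extend_supported m (c : chain K m) : extend c \in supported (faces K).
Proof.
by apply/supportedP => F FK; rewrite extend_notin // negb_and FK.
Qed.

Lemma extend_is_zmod_morphism m : zmod_morphism (@extend m).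
Proof.
move=> c d; apply/ffunP => F; rewrite !ffunE.
by case: insubP => [s _ _|_]; rewrite /= ?ffunE ?subr0.
Qed.

HB.instance Definition _ m :=
  GRing.isZmodMorphism.Build (chain K m) (total_chain V) (@extend m)
    (@extend_is_zmod_morphism m).

Lemma extend_component m c F : c \in supported (faces K) ->
  extend (component m c) F = if #|F| == m then c F else 0.
Proof.
move=> /supportedP cK; rewrite ffunE; case: insubP => [s /andP[_ ->] <-|] /=.
  by rewrite ffunE.
by rewrite negb_and => /orP[/cK->|/negPf->]; rewrite ?if_same.
Qed.

Lemma boundary_component m c : c \in supported (faces K) ->
  boundary (component m.+1 c) = component m (total_boundary c).
Proof.
move=> /supportedP cK; apply/ffunP => G; rewrite !ffunE.
have /andP[GK /eqP cardG] := valP G.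
under eq_bigr => F _ do rewrite ffunE /incidence mulr_sumr.
rewrite (exchange_big_dep xpredT) //= [RHS]big_mkcond; apply: eq_bigr => v _.
case: ifP => vG; last first.
  rewrite big_pred0 // => F; apply/negP => /andP[_ /eqP FvG].
  by rewrite -FvG !inE eqxx in vG.
have FvE (F : simplex K m.+1) :
    (v \in val F) && (val F :\ v == val G) = (val F == v |: val G).
  apply/andP/eqP => [[vF /eqP<-]|->]; first by rewrite setD1K.
  by rewrite setU11 setU1K.
rewrite (eq_bigl _ _ FvE).
have [vGK|vGK] := boolP (v |: val G \in faces K); last first.
  rewrite cK // mulr0 big_pred0 // => F; apply/eqP => FvG.
  by case/andP: (valP F); rewrite FvG (negPf vGK).
have vGP : (v |: val G \in faces K) && (#|v |: val G| == m.+1).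
  by rewrite vGK cardsU1 vG cardG add1n eqxx.
rewrite (big_pred1 (Sub (v |: val G) vGP : simplex K m.+1)) => [|F] /=.
  by rewrite mulrC.
by rewrite -val_eqE.
Qed.

Lemma total_boundary_extend m (c : chain K m.+1) :
  total_boundary (extend c) = extend (boundary c).
Proof.
have cK := extend_supported c.
have dcK := total_boundary_supported (@face_sub _ K) cK.
apply/ffunP => F; rewrite -{2}[c]extendK boundary_component //.
rewrite extend_component //; case: eqP => // cardF.
rewrite ffunE big1 // => v vF; rewrite extend_notin ?mulr0 //.
by rewrite negb_and cardsU1 vF eqSS; apply/orP; right; apply/eqP.
Qed.

End GradedComponents.

Section FullSimplex.
Local Open Scope ring_scope.
Variable V : finType.

Fact full_simplex_face_sub (F G : {set V}) :
  F \in [set: {set V}] -> G \subset F -> G \in [set: {set V}].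
Proof. by rewrite !inE. Qed.

Definition full_simplex : simplicial_complex V :=
  SimplicialComplex (in_setT set0) (fun v => in_setT [set v])
    full_simplex_face_sub.

Lemma total_boundary_boundary (c : total_chain V) :
  total_boundary (total_boundary c) = 0.
Proof.
have fullS (d : total_chain V) : d \in supported (faces full_simplex).
  by apply/supportedP => F; rewrite inE.
apply/ffunP => G.
have GP : (G \in faces full_simplex) && (#|G| == #|G|) by rewrite inE eqxx.
have := boundary_boundary (component full_simplex #|G|.+2 c).
rewrite !boundary_component // => /ffunP/(_ (Sub G GP)).
by rewrite [LHS]ffunE [RHS]ffunE SubK => ->; rewrite ffunE.
Qed.

End FullSimplex.

Section Acyclicity.
Local Open Scope ring_scope.
Variable V : finType.
Implicit Types A B : {set {set V}}.

Definition acyclic A : Prop :=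
  forall z, z \in supported A -> total_boundary z = 0 ->
  exists2 c, c \in supported A & total_boundary c = z.

Lemma acyclic0 : acyclic set0.
Proof.
move=> z /supportedP z0 _; exists 0; first exact: rpred0.
by rewrite raddf0; apply/ffunP => F; rewrite z0 ?ffunE ?inE.
Qed.

Lemma acyclic_cone v A : cone_closed v A -> acyclic A.
Proof.
move=> coneA z zA dz; exists (cone v z); first exact: cone_supported.
have := total_boundary_cone v z; rewrite dz => dcone.
rewrite -[RHS]dcone [X in _ + X](_ : _ = 0) ?addr0 //.
by apply/ffunP => F; rewrite !ffunE mulr0 if_same.
Qed.

(* The connecting map of Mayer-Vietoris: splitting z = a + b along A and B, the
   common boundary of a and - b is a cycle of the intersection. *)
Lemma acyclicU A B : down_closed A -> down_closed B ->
  acyclic A -> acyclic B -> acyclic (A :&: B) -> acyclic (A :|: B).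
Proof.
move=> downA downB acyA acyB acyAB z /supportedU[a aA bB] dz.
have daAB : total_boundary a \in supported (A :&: B).
  rewrite supportedI total_boundary_supported //=.
  rewrite -[a](subKr z) raddfB /= dz sub0r rpredN.
  exact: total_boundary_supported.
have [e] := acyAB _ daAB (total_boundary_boundary a).
rewrite supportedI => /andP[eA eB] de.
have [||c cA dc] := acyA (a - e); first exact: rpredB.
  by rewrite raddfB /= de subrr.
have [||c' c'B dc'] := acyB (z - a + e); first exact: rpredD.
  by rewrite raddfD raddfB /= de dz sub0r addNr.
exists (c + c').
  by apply: rpredD; [apply: supportedS cA | apply: supportedS c'B];
    rewrite ?subsetUl ?subsetUr.
by rewrite raddfD /= dc dc' addrC -addrA [e + _]addrC !subrK.
Qed.

End Acyclicity.

Section Stars.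
Variables (V : finType) (K : simplicial_complex V).

Definition star (v : V) : {set {set V}} := [set F | v |: F \in faces K].

Lemma star_subset v : star v \subset faces K.
Proof.
by apply/subsetP => F; rewrite inE => /face_sub; apply; apply: subsetUr.
Qed.

Lemma star_down_closed v : down_closed (star v).
Proof.
by move=> F G; rewrite !inE => vF /(setUS [set v]); apply: face_sub.
Qed.

Lemma star_cone_closed v : cone_closed v (star v).
Proof. by move=> F; rewrite !inE setUA setUid. Qed.

Lemma acyclic_bigcup_star (I : finType) (v : I -> V) :
  (forall i k F, v i |: F \in faces K -> v k |: F \in faces K ->
     v i |: (v k |: F) \in faces K) ->
  acyclic (\bigcup_i star (v i)).
Proof.
move=> joinK.
pose join_closed (A : {set {set V}}) :=
  forall i F, F \in A -> F \in star (v i) -> v i |: F \in A.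
suff [] : [/\ down_closed (\bigcup_i star (v i)),
              acyclic (\bigcup_i star (v i))
            & join_closed (\bigcup_i star (v i))] by [].
elim/big_rec: _ => [|i A _ [downA acyA joinA]].
  by split=> [F G||i F]; rewrite ?inE //; apply: acyclic0.
split.
- move=> F G /setUP[FA|FA] GF; apply/setUP.
    by left; apply: star_down_closed GF.
  by right; apply: downA GF.
- apply: acyclicU => //; first exact: star_down_closed.
    exact: acyclic_cone (@star_cone_closed _).
  apply: (@acyclic_cone _ (v i)) => F /setIP[Fi FA].
  by rewrite inE star_cone_closed // joinA.
- move=> k F /setUP[Fi|FA] Fk; apply/setUP; last by right; apply: joinA.
  by left; move: Fi Fk; rewrite !inE => *; apply: joinK.
Qed.

End Stars.

Section FacetsOutsideAcyclic.
Local Open Scope ring_scope.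
Variables (V : finType) (K : simplicial_complex V).
Variables (L : {set {set V}}) (m : nat).
Hypothesis L_subset : L \subset faces K.
Hypothesis L_acyclic : acyclic L.
Hypothesis outside_maximal : forall F v,
  F \in faces K :\: L -> v \notin F -> v |: F \notin faces K.

Definition outside_faces : {set {set V}} :=
  [set F in faces K :\: L | #|F| == m.+1].

Definition outside_coefs (z : cycle_group K m) : 'rV[int]_#|outside_faces| :=
  \row_i extend (val z) (enum_val i).

Fact outside_coefs_is_zmod_morphism : zmod_morphism outside_coefs.
Proof. by move=> y z; apply/rowP => i; rewrite !mxE !raddfB !ffunE. Qed.

HB.instance Definition _ :=
  GRing.isZmodMorphism.Build (cycle_group K m) 'rV[int]_#|outside_faces|
    outside_coefs outside_coefs_is_zmod_morphism.

Lemma total_boundary_supportedL c :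
  c \in supported (faces K) -> total_boundary c \in supported L.
Proof.
move=> /supportedP cK; apply/supportedP => F FL; rewrite ffunE big1 // => v vF.
rewrite cK ?mulr0 //; apply/negP => vFK.
have FK := face_sub vFK (subsetUr _ _).
by move: vFK; apply/negP/outside_maximal; rewrite // inE FL.
Qed.

Lemma outside_coefs_eq0 (z : cycle_group K m) :
  (outside_coefs z == 0) = (z \in @boundary_pred V K m).
Proof.
rewrite [RHS]inE; apply/eqP/asboolP => [/rowP z0|[c dc]]; last first.
  apply/rowP => i; rewrite !mxE -dc -total_boundary_extend.
  have /supportedP-> // := total_boundary_supportedL (extend_supported c).
  by have := enum_valP i; rewrite !inE => /andP[/andP[]].
have zL : extend (val z) \in supported L.
  apply/supportedP => F FL; have [FC|] := boolP (F \in outside_faces).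
    by have := z0 (enum_rank_in FC F); rewrite !mxE enum_rankK_in.
  by rewrite !inE FL => /extend_notin->.
have dz : total_boundary (extend (val z)) = 0.
  by have /eqP dz := valP z; rewrite total_boundary_extend dz raddf0.
have [c cL dc] := L_acyclic zL dz.
exists (component K m.+2 c).
by rewrite boundary_component ?dc ?extendK //; apply: supportedS cL.
Qed.

Lemma outside_coefs_surj (a : 'rV[int]_#|outside_faces|) :
  exists z, outside_coefs z = a.
Proof.
have [b bC b_coefs] := supported_row a.
have bK : b \in supported (faces K).
  by apply: supportedS bC; apply/subsetP => F; rewrite !inE => /andP[/andP[]].
have [c cL dc] := L_acyclic (total_boundary_supportedL bK)
  (total_boundary_boundary b).
have bcK : b - c \in supported (faces K).
  by apply: rpredB => //; apply: supportedS cL.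
have bc_cycle : component K m.+1 (b - c) \in @cycle_pred V K m.
  rewrite inE boundary_component // raddfB /= dc subrr.
  by apply/eqP/ffunP => F; rewrite !ffunE.
exists (Cycle bc_cycle); apply/rowP => i; rewrite mxE extend_component //.
have := enum_valP i; rewrite !inE => /andP[/andP[iL _] ->].
by rewrite !ffunE b_coefs (supportedP _ _ cL) ?subr0.
Qed.

Lemma homology_facets_outside_acyclic :
  isomorphic_zmod (reduced_homology K m) 'rV[int]_#|outside_faces|.
Proof. exact: quot_isomorphic outside_coefs_surj outside_coefs_eq0. Qed.

End FacetsOutsideAcyclic.

Section PartialPartitionComplex.
Variable n : nat.
Local Notation block := (nonempty_subset n).
Implicit Types (i k : 'I_n) (B : block).
Implicit Types (F : {set block}) (P : {set {set 'I_n}}).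

Lemma set1_neq0 i : [set i] != set0.
Proof. by apply/set0Pn; exists i; rewrite inE. Qed.

Definition singleton i : block := Sub [set i] (set1_neq0 i).

Definition blocks F : {set {set 'I_n}} := [set val B | B in F].

Lemma blocks_inj : injective blocks.
Proof. exact/imset_inj/val_inj. Qed.

Lemma card_blocks F : #|blocks F| = #|F|.
Proof. exact/card_imset/val_inj. Qed.

Lemma set0_notin_blocks F : set0 \notin blocks F.
Proof. by apply/imsetP => -[B _ B0]; have := valP B; rewrite -B0 eqxx. Qed.

Lemma blocks_surj P : set0 \notin P -> exists F, blocks F = P.
Proof.
move=> P0; exists [set B : block | val B \in P].
apply/setP => S; apply/imsetP/idP => [[B + ->]|SP]; first by rewrite inE.
have nS : S != set0 by apply: contraNneq P0 => <-.
by exists (Sub S nS : block); rewrite ?inE.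
Qed.

Lemma mem_Dn F : (F \in faces (Dn n)) = trivIset (blocks F).
Proof. by rewrite inE /partial_partition set0_notin_blocks andbT. Qed.

Lemma mem_DnP F :
  reflect {in F &, forall B B', B != B' -> [disjoint val B & val B']}
          (F \in faces (Dn n)).
Proof.
rewrite mem_Dn; apply: (iffP trivIsetP) => [tF B B' BF BF' nB|dF S S'].
  by apply: tF; rewrite ?imset_f // (inj_eq val_inj).
move=> /imsetP[B BF ->] /imsetP[B' BF' ->].
by rewrite (inj_eq val_inj); apply: dF.
Qed.

Lemma setU1_Dn B F : F \in faces (Dn n) ->
  {in F, forall B', B != B' -> [disjoint val B & val B']} ->
  B |: F \in faces (Dn n).
Proof.
move=> /mem_DnP dF dB; apply/mem_DnP => B1 B2.
move=> /setU1P[->|F1] /setU1P[->|F2]; rewrite ?eqxx //.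
- exact: dB.
- by rewrite eq_sym disjoint_sym; apply: dB.
- exact: dF.
Qed.

Lemma star_singletonP i F : F \in faces (Dn n) ->
  reflect {in F, forall B, i \in val B -> B = singleton i}
          (F \in star (Dn n) (singleton i)).
Proof.
move=> FD; rewrite inE; apply: (iffP idP) => [/mem_DnP dF B BF|iF].
  apply: contraTeq; rewrite eq_sym => /dF; rewrite disjoints1.
  by apply; rewrite ?setU11 ?setU1r.
apply: setU1_Dn => // B BF; apply: contraNT; rewrite disjoints1 negbK.
by move/(iF B BF)->.
Qed.

Lemma singletons_join_Dn i k F :
  singleton i |: F \in faces (Dn n) -> singleton k |: F \in faces (Dn n) ->
  singleton i |: (singleton k |: F) \in faces (Dn n).
Proof.
move=> /mem_DnP iF kF; apply: setU1_Dn => // B /setU1P[->|BF].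
  by rewrite disjoints1 inE; apply: contraNN => /eqP->.
by apply: iF; rewrite ?setU11 ?setU1r.
Qed.

Definition singleton_stars : {set {set block}} :=
  \bigcup_i star (Dn n) (singleton i).

Lemma singleton_stars_subset : singleton_stars \subset faces (Dn n).
Proof. by apply/bigcupsP => i _; apply: star_subset. Qed.

Lemma singleton_stars_acyclic : acyclic singleton_stars.
Proof. exact: acyclic_bigcup_star singletons_join_Dn. Qed.

Lemma notin_singleton_starsP F : F \in faces (Dn n) ->
  reflect (forall i, exists B, [/\ B \in F, i \in val B & B != singleton i])
          (F \notin singleton_stars).
Proof.
move=> FD; apply: (iffP idP) => [Fstars i|covF]; last first.
  apply/bigcupP => -[i _ /(star_singletonP i FD) iF].
  by have [B [BF iB /eqP[]]] := covF i; apply: iF.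
apply: contrapT => notB; case/bigcupP: Fstars; exists i => //.
apply/star_singletonP => // B BF iB; apply: contrapT => /eqP nB.
by apply: notB; exists B.
Qed.

Definition nosingleton_partition P : bool :=
  partition P [set: 'I_n] && [forall S in P, #|S| != 1].

Lemma notin_singleton_stars F : F \in faces (Dn n) ->
  (F \notin singleton_stars) = nosingleton_partition (blocks F).
Proof.
move=> FD; have tF := FD; rewrite mem_Dn in tF.
apply/(notin_singleton_starsP FD)/andP => [covF|[/and3P[/eqP covF _ _]]].
  split.
    rewrite /partition tF set0_notin_blocks !andbT eqEsubset subsetT.
    apply/subsetP => i _; have [B [BF iB _]] := covF i.
    by apply/bigcupP; exists (val B); rewrite ?imset_f.
  apply/forall_inP => _ /imsetP[B BF ->]; apply/cards1P => -[i Bi].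
  have {Bi} Bi : B = singleton i by apply: val_inj.
  have [B' [B'F iB' /eqP[]]] := covF i.
  have iF : F \in star (Dn n) (singleton i).
    by rewrite inE -Bi (setUidPr _) // sub1set.
  exact: (star_singletonP i FD iF).
move=> /forall_inP no1 i; have : i \in cover (blocks F) by rewrite covF inE.
move=> /bigcupP[_ /imsetP[B BF ->] iB]; exists B; split=> //.
apply/eqP => Bi.
by have := no1 _ (imset_f val BF); rewrite Bi cards1.
Qed.

Lemma notin_singleton_stars_maximal F B :
  F \in faces (Dn n) :\: singleton_stars -> B \notin F ->
  B |: F \notin faces (Dn n).
Proof.
move=> /setDP[FD /(notin_singleton_starsP FD) covF] BF.
have /set0Pn[i iB] := valP B; have [B' [B'F iB' _]] := covF i.
apply/mem_DnP => /(_ B B' (setU11 _ _) (setU1r _ B'F)).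
have -> : B != B' by apply: contraNneq BF => ->.
by move=> /(_ isT)/disjointFr/(_ iB); rewrite iB'.
Qed.

Lemma card_outside_singleton_stars m :
  #|outside_faces (Dn n) singleton_stars m| = num_nosingleton_partitions n m.+1.
Proof.
rewrite -(card_imset _ blocks_inj); apply: eq_card => P.
rewrite [RHS]inE andbCA -/(nosingleton_partition P) andbC.
apply/imsetP/andP => [[F /setIdP[/setDP[FD Fstars] cardF] ->]|[]].
  by rewrite card_blocks -notin_singleton_stars.
move=> partP; have /andP[/and3P[_ tP P0] _] := partP.
have [F FP] := blocks_surj P0; rewrite -FP in partP tP *.
rewrite -mem_Dn in tP; rewrite card_blocks => cardF.
exists F => //; apply/setIdP; split=> //; apply/setDP.
by rewrite notin_singleton_stars.
Qed.

End PartialPartitionComplex.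

Theorem theorem3p4 (n j : nat) (hj : 1 <= j <= n) :
  isomorphic_zmod (reduced_homology (Dn n) j.-1)
                  'rV[int]_(num_nosingleton_partitions n j).
Proof.
case: j hj => // m _; rewrite -card_outside_singleton_stars.
apply: homology_facets_outside_acyclic.
- exact: singleton_stars_subset.
- exact: singleton_stars_acyclic.
- exact: notin_singleton_stars_maximal.
Qed.
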